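(* Assume $\Sigma_n$ and $V_n$ are invertible and let $\widehat{\Omega}$ be any estimator (random symmetric $d\times d$ matrix with positive diagonal entries) of $\Omega_n := \Sigma_n^{-1}V_n\Sigma_n^{-1}$. For any $\eta_n>0$, \[ \sup_{t\ge0}\left|\mathbb{P}\left(\max_{1\le j\le d}\left|\frac{\widehat{\beta}_j - \beta_j}{\sqrt{\widehat{\Omega}_{jj}}}\right| \le t\right) - \mathbb{P}\left(\max_{1\le j\le d}|G_j| \le t\right)\right| \le 2\Delta_n + \mathbb{P}(\mathcal{E}_{\eta_n}^c) + C_n(\eta_n)\eta_n\Phi_{AC} + \frac{d}{n}, \] where $C_n(\eta_n) := 2\kappa_n + 2\kappa_n\eta_n + \sqrt{2\log(2n)}$ with $\kappa_n := \kappa(\Sigma_n^{-1/2}V_n^{1/2})$.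
   Context: Let $(X_1,Y_1),\dots,(X_n,Y_n)$ be random elements of $\mathbb{R}^d\times\mathbb{R}$ (no independence assumed) with finite second moments. Define $\Sigma_n := n^{-1}\sum_i\mathbb{E}[X_iX_i^\top]$, $\Gamma_n := n^{-1}\sum_i\mathbb{E}[X_iY_i]$, $\beta := \Sigma_n^{-1}\Gamma_n$, $\widehat{\Sigma}_n := n^{-1}\sum_i X_iX_i^\top$, $\widehat{\Gamma}_n := n^{-1}\sum_i X_iY_i$, $\widehat\beta := \widehat{\Sigma}_n^{-1}\widehat{\Gamma}_n$, $V_n := \mathrm{Var}(n^{-1}\sum_i X_i(Y_i - X_i^\top\beta))$, $\psi_i := \Sigma_n^{-1}X_i(Y_i-X_i^\top\beta)$ with coordinates $\psi_{ij}$, and $\mathcal{D}_n^{\Sigma} := \|\Sigma_n^{-1/2}\widehat{\Sigma}_n\Sigma_n^{-1/2} - I_d\|_{\mathrm{op}}$. For positive definite $A$, $\|x\|_A:=\sqrt{x^\top Ax}$; $\kappa(A):=\|A^{-1}\|_{\mathrm{op}}\|A\|_{\mathrm{op}}$. For a positive definite matrix $A$, $\mathrm{Corr}(A) := \mathrm{diag}(A)^{-1/2}A\,\mathrm{diag}(A)^{-1/2}$. Let $G=(G_1,\dots,G_d)$ be a centered Gaussian vector with $\mathrm{Var}(G) = \mathrm{Corr}(\Sigma_n^{-1}V_n\Sigma_n^{-1})$. Define \[ \Delta_n := \sup_{t\ge0}\left|\mathbb{P}\left(\max_{j}\left|\frac{n^{-1}\sum_{i=1}^n\psi_{ij}}{\sqrt{(\Omega_n)_{jj}}}\right|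 \le t\right) - \mathbb{P}\left(\max_{j}|G_j| \le t\right)\right|,\qquad \Phi_{AC} := \sup_{t\ge0,\varepsilon>0}\frac{1}{\varepsilon}\mathbb{P}\Big(t \le \max_{j}|G_j| \le t+\varepsilon\Big), \] and the event \[ \mathcal{E}_{\eta_n} := \{\mathcal{D}_n^{\Sigma} \le 1/2\}\cap\Big\{\mathcal{D}_n^{\Sigma}\big\|n^{-1}\textstyle\sum_i\psi_i\big\|_{\Sigma_nV_n^{-1}\Sigma_n} \le \eta_n\Big\}\cap\Big\{\max_{j}\Big|\sqrt{(\Omega_n)_{jj}/\widehat\Omega_{jj}} - 1\Big| \le \eta_n\Big\}. \] *)

(* Defs.v *)
From HB Require Import structures.
From mathcomp Require Import all_boot all_order all_algebra.
From mathcomp Require Import all_classical all_reals all_analysis.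
Set Implicit Arguments. Unset Strict Implicit. Unset Printing Implicit Defensive.
Import Order.TTheory GRing.Theory Num.Theory.
Local Open Scope classical_set_scope.
Local Open Scope ring_scope.

Section Defs.
Context {R : realType}.

Definition vnorm2 (m : nat) (x : 'cV[R]_m) : R :=
  Num.sqrt (\sum_(a < m) x a 0 ^+ 2).

Definition opnorm (m : nat) (A : 'M[R]_m) : R :=
  sup [set vnorm2 (A *m x) | x in [set x : 'cV[R]_m | vnorm2 x <= 1]].

Definition cond_num (m : nat) (A : 'M[R]_m) : R := opnorm (invmx A) * opnorm A.

Definition psd (m : nat) (A : 'M[R]_m) : Prop :=
  A^T = A /\ forall x : 'cV[R]_m, 0 <= (x^T *m A *m x) 0 0.

(* the (unique) symmetric positive semidefinite square root A^{1/2} *)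
Definition psd_sqrt (m : nat) (A : 'M[R]_m) : 'M[R]_m :=
  xget 0 [set S : 'M[R]_m | psd S /\ S *m S = A].

Definition wnorm (m : nat) (A : 'M[R]_m) (x : 'cV[R]_m) : R :=
  Num.sqrt ((x^T *m A *m x) 0 0).

Definition corrmx (m : nat) (A : 'M[R]_m) : 'M[R]_m :=
  \matrix_(a, b) (A a b / (Num.sqrt (A a a) * Num.sqrt (A b b))).

(* max over coordinates of nonnegative quantities (0 for the empty index set) *)
Definition maxj (m : nat) (f : 'I_m -> R) : R := \big[Num.max/0]_(j < m) f j.

Context {dT : measure_display} {T : measurableType dT} (P : probability T R).

(* real-valued expectation (for integrable variables) *)
Definition Er (f : T -> R) : R := fine ('E_P[f])%E.

Definition varmx (m : nat) (Z : T -> 'cV[R]_m) : 'M[R]_m :=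
  \matrix_(a, b) Er (fun w => (Z w a 0 - Er (fun w' => Z w' a 0)) *
                               (Z w b 0 - Er (fun w' => Z w' b 0))).

Variables (n m : nat) (X : 'I_n -> T -> 'cV[R]_m) (Y : 'I_n -> T -> R).

Definition Sigma_n : 'M[R]_m :=
  n%:R^-1 *: \sum_(i < n) \matrix_(a, b) Er (fun w => X i w a 0 * X i w b 0).
Definition Gamma_n : 'cV[R]_m :=
  n%:R^-1 *: \sum_(i < n) \col_a Er (fun w => X i w a 0 * Y i w).
Definition beta_n : 'cV[R]_m := invmx Sigma_n *m Gamma_n.

Definition Sigma_hat (w : T) : 'M[R]_m :=
  n%:R^-1 *: \sum_(i < n) (X i w *m (X i w)^T).
Definition Gamma_hat (w : T) : 'cV[R]_m :=
  n%:R^-1 *: \sum_(i < n) (Y i w *: X i w).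
Definition beta_hat (w : T) : 'cV[R]_m := invmx (Sigma_hat w) *m Gamma_hat w.

Definition resid (i : 'I_n) (w : T) : R := Y i w - ((X i w)^T *m beta_n) 0 0.

Definition V_n : 'M[R]_m :=
  varmx (fun w => n%:R^-1 *: \sum_(i < n) (resid i w *: X i w)).

Definition Omega_n : 'M[R]_m := invmx Sigma_n *m V_n *m invmx Sigma_n.

Definition psi (i : 'I_n) (w : T) : 'cV[R]_m :=
  resid i w *: (invmx Sigma_n *m X i w).

Definition psi_bar (w : T) : 'cV[R]_m := n%:R^-1 *: \sum_(i < n) psi i w.

Definition Sigma_isqrt : 'M[R]_m := invmx (psd_sqrt Sigma_n).

Definition D_Sigma (w : T) : R :=
  opnorm (Sigma_isqrt *m Sigma_hat w *m Sigma_isqrt - 1%:M).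

Definition kappa_n : R := cond_num (Sigma_isqrt *m psd_sqrt V_n).

Definition C_n (eta : R) : R :=
  2 * kappa_n + 2 * kappa_n * eta + Num.sqrt (2 * ln (2 * n%:R)).

Definition event_E (Omega_hat : T -> 'M[R]_m) (eta : R) : set T :=
  [set w | D_Sigma w <= 2^-1] `&`
  [set w | D_Sigma w * wnorm (Sigma_n *m invmx V_n *m Sigma_n) (psi_bar w) <= eta] `&`
  [set w | maxj (fun j => `|Num.sqrt (Omega_n j j / Omega_hat w j j) - 1|) <= eta].

End Defs.

(* G is a centered Gaussian vector with covariance matrix S:
   every linear combination a^T G is N(0, a^T S a) (a point mass at 0 if a^T S a = 0) *)
Definition gaussian_vector {R : realType} {dT : measure_display} {T : measurableType dT}
  (P : probability T R) (m : nat) (G : T -> 'cV[R]_m) (S : 'M[R]_m) : Prop :=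
  (forall j : 'I_m, measurable_fun setT (fun w => G w j 0)) /\
  forall a : 'cV[R]_m,
    let q := (a^T *m S *m a) 0 0 in
    (0 < q -> forall B : set R, measurable B ->
       P [set w | ((a^T *m G w) 0 0) \in B] = normal_prob 0 (Num.sqrt q) B) /\
    (q = 0 -> P [set w | (a^T *m G w) 0 0 = 0] = 1%E).

(* Main.v *)
Require Import Defs.
From HB Require Import structures.
From mathcomp Require Import all_boot all_order all_algebra.
From mathcomp Require Import complex.
From mathcomp Require Import all_classical all_reals all_analysis.
From mathcomp Require Import measurable_realfun.
From mathcomp Require Import ring lra.
Import Order.TTheory GRing.Theory Num.Theory.
Local Open Scope classical_set_scope.
Local Open Scope ring_scope.

(* The normal equations give Sigma_hat (beta_hat - beta) = Sigma psi_bar.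
   Whitening by Sigma^{1/2}, on D_Sigma <= 1/2 the remainder
   u = beta_hat - beta - psi_bar has norm at most 2 kappa D_Sigma |psi_bar| in the
   norm dual to Omega, hence |u_j| <= 2 kappa eta sqrt(Omega_jj) on the event E.
   Replacing Omega_hat_jj by Omega_jj costs a factor 1 +- eta, so on E and on
   {Sstat <= s}, s = sqrt(2 log(2n)), the statistics Tstat and Sstat differ by at
   most C_n(eta) eta. The Gaussian union bound gives P(max_j |G_j| > s) <= d/n, and
   comparing distribution functions twice with those of max_j |G_j| (at
   t +- C_n(eta) eta and at s) costs 2 Delta_n, with anti-concentration absorbing
   the shift.

   Only second moments of (X_i, Y_i) are assumed, so an entry of V_n may be the
   expectation of a non-integrable variable, with junk value 0, and V_n need not
   be positive semidefinite. If all Omega_jj > 0, the existence of the Gaussian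
   vector G forces Corr(Omega), hence V_n, to be positive semidefinite.
   Otherwise the right-hand side is at least 1: E is empty if eta < 1, and if
   eta >= 1 the last two terms dominate P(max_j |G_j| <= s) + d/n. *)

(** * Euclidean and operator norms, square roots *)

Section VectorNorm.
Context {R : realType}.
Implicit Types (m : nat).

Lemma dotvE m (x y : 'cV[R]_m) : (x^T *m y) 0 0 = \sum_a x a 0 * y a 0.
Proof. by rewrite mxE; apply: eq_bigr => a _; rewrite mxE. Qed.

Lemma vnorm2_ge0 m (x : 'cV[R]_m) : 0 <= vnorm2 x.
Proof. exact: sqrtr_ge0. Qed.

Lemma sqr_vnorm2 m (x : 'cV[R]_m) : vnorm2 x ^+ 2 = (x^T *m x) 0 0.
Proof.
rewrite /vnorm2 sqr_sqrtr; last by apply: sumr_ge0 => a _; rewrite sqr_ge0.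
by rewrite dotvE; apply: eq_bigr => a _; rewrite expr2.
Qed.

Lemma vnorm2_def m (x : 'cV[R]_m) : vnorm2 x = Num.sqrt ((x^T *m x) 0 0).
Proof. by rewrite -sqr_vnorm2 sqrtr_sqr ger0_norm ?vnorm2_ge0. Qed.

Lemma vnorm2_eq0 m (x : 'cV[R]_m) : vnorm2 x = 0 -> x = 0.
Proof.
move=> x0; have /eqP : \sum_a x a 0 ^+ 2 = 0.
  have := sqr_vnorm2 _ x; rewrite x0 expr0n/= dotvE => h.
  by rewrite [RHS]h; apply: eq_bigr => a _; rewrite expr2.
rewrite psumr_eq0; last by move=> a _; rewrite sqr_ge0.
move=> /allP h; apply/matrixP => a b; rewrite ord1 [RHS]mxE.
by apply/eqP; rewrite -sqrf_eq0; apply: h; rewrite mem_index_enum.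
Qed.

Lemma vnorm20 m : vnorm2 (0 : 'cV[R]_m) = 0.
Proof. by rewrite vnorm2_def trmx0 mul0mx mxE sqrtr0. Qed.

Lemma vnorm2Z m (a : R) (x : 'cV[R]_m) : vnorm2 (a *: x) = `|a| * vnorm2 x.
Proof.
rewrite /vnorm2 -sqrtr_sqr -sqrtrM ?sqr_ge0// mulr_sumr; congr Num.sqrt.
by apply: eq_bigr => i _; rewrite mxE exprMn.
Qed.

Lemma vnorm2N m (x : 'cV[R]_m) : vnorm2 (- x) = vnorm2 x.
Proof. by rewrite -scaleN1r vnorm2Z normrN1 mul1r. Qed.

Lemma vnorm2_lin m (a b : R) (x y : 'cV[R]_m) :
  vnorm2 (a *: x + b *: y) ^+ 2 =
  a ^+ 2 * vnorm2 x ^+ 2 + 2 * (a * b) * (x^T *m y) 0 0 + b ^+ 2 * vnorm2 y ^+ 2.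
Proof.
rewrite !sqr_vnorm2 !dotvE !mulr_sumr -!big_split/=.
by apply: eq_bigr => i _; rewrite !mxE; ring.
Qed.

(** Cauchy-Schwarz: expand the nonnegative squared norm of [|y| x - |x| y] and cancel the positive
    factor [|x| |y|]. *)
Lemma dotv_le m (x y : 'cV[R]_m) : (x^T *m y) 0 0 <= vnorm2 x * vnorm2 y.
Proof.
have [/vnorm2_eq0->|x0] := eqVneq (vnorm2 x) 0.
  by rewrite trmx0 mul0mx mxE vnorm20 mul0r.
have [/vnorm2_eq0->|y0] := eqVneq (vnorm2 y) 0.
  by rewrite mulmx0 mxE vnorm20 mulr0.
have {}x0 : 0 < vnorm2 x by rewrite lt_neqAle eq_sym x0 vnorm2_ge0.
have {}y0 : 0 < vnorm2 y by rewrite lt_neqAle eq_sym y0 vnorm2_ge0.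
have := sqr_ge0 (vnorm2 (vnorm2 y *: x + (- vnorm2 x) *: y)).
rewrite vnorm2_lin => h; rewrite -(ler_pM2l (mulr_gt0 x0 y0)); move: h.
set p := (x^T *m y) 0 0; set a := vnorm2 x; set b := vnorm2 y.
by lra.
Qed.

Lemma normr_dotv_le m (x y : 'cV[R]_m) :
  `|(x^T *m y) 0 0| <= vnorm2 x * vnorm2 y.
Proof.
rewrite ler_norml dotv_le andbT lerNl.
by have := dotv_le _ (- x) y; rewrite linearN/= mulNmx mxE vnorm2N.
Qed.

Lemma ler_vnorm2D m (x y : 'cV[R]_m) : vnorm2 (x + y) <= vnorm2 x + vnorm2 y.
Proof.
rewrite -ler_sqr ?nnegrE ?addr_ge0 ?vnorm2_ge0//.
have := vnorm2_lin _ 1 1 x y; rewrite !scale1r => ->.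
by have := dotv_le _ x y; lra.
Qed.

(** Cauchy-Schwarz on each row gives the Frobenius norm as constant. The set in [opnorm] is
    therefore bounded and its [sup] is a genuine supremum. *)
Lemma mulmx_bounded m (A : 'M[R]_m) :
  exists2 K : R, 0 <= K & forall x : 'cV_m, vnorm2 (A *m x) <= K * vnorm2 x.
Proof.
exists (Num.sqrt (\sum_i vnorm2 (row i A)^T ^+ 2)) => [|x]; first exact: sqrtr_ge0.
rewrite -ler_sqr ?nnegrE ?mulr_ge0 ?vnorm2_ge0 ?sqrtr_ge0//.
rewrite [leLHS]sqr_vnorm2 exprMn sqr_sqrtr; last first.
  by apply: sumr_ge0 => i _; rewrite sqr_ge0.
rewrite dotvE mulr_suml; apply: ler_sum => i _.
rewrite -exprMn -expr2 -[leLHS]real_normK ?num_real//.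
rewrite ler_sqr ?nnegrE ?mulr_ge0 ?vnorm2_ge0//.
by have := normr_dotv_le _ (row i A)^T x; rewrite trmxK -row_mul mxE.
Qed.

Lemma opnorm_has_sup m (A : 'M[R]_m) :
  has_sup [set vnorm2 (A *m x) | x in [set x : 'cV[R]_m | vnorm2 x <= 1]].
Proof.
split; first by exists (vnorm2 (A *m 0)), 0 => //=; rewrite vnorm20 ler01.
have [K K0 hK] := mulmx_bounded _ A.
exists K => _ [x /= x1 <-]; apply: le_trans (hK x) _.
by rewrite ler_piMr.
Qed.

Lemma opnorm_ge0 m (A : 'M[R]_m) : 0 <= opnorm A.
Proof.
apply: (ub_le_sup (proj2 (opnorm_has_sup m A))).
by exists 0; rewrite /= ?mulmx0 vnorm20 ?ler01.
Qed.

Lemma vnorm2_opnorm m (A : 'M[R]_m) (x : 'cV_m) :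
  vnorm2 (A *m x) <= opnorm A * vnorm2 x.
Proof.
have [/vnorm2_eq0->|x0] := eqVneq (vnorm2 x) 0.
  by rewrite mulmx0 vnorm20 mulr0.
have {}x0 : 0 < vnorm2 x by rewrite lt_neqAle eq_sym x0 vnorm2_ge0.
rewrite -ler_pdivrMr//; apply: (ub_le_sup (proj2 (opnorm_has_sup m A))).
have xV : `|(vnorm2 x)^-1| = (vnorm2 x)^-1 by rewrite ger0_norm// invr_ge0 ltW.
exists ((vnorm2 x)^-1 *: x) => /=; first by rewrite vnorm2Z xV mulVf ?gt_eqF.
by rewrite -scalemxAr vnorm2Z xV mulrC.
Qed.

Lemma opnorm_leP m (A : 'M[R]_m) (c : R) : 0 <= c ->
  opnorm A <= c <-> forall x : 'cV_m, vnorm2 (A *m x) <= c * vnorm2 x.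
Proof.
move=> c0; split=> [Ac x|h].
  by rewrite (le_trans (vnorm2_opnorm _ _ _))// ler_wpM2r ?vnorm2_ge0.
apply: ge_sup; first exact: (proj1 (opnorm_has_sup m A)).
move=> _ [x /= x1 <-]; apply: le_trans (h x) _.
by rewrite ler_piMr.
Qed.

Lemma cond_num_ge0 m (A : 'M[R]_m) : 0 <= cond_num A.
Proof. by rewrite mulr_ge0 ?opnorm_ge0. Qed.

End VectorNorm.

(** * Existence of positive semidefinite square roots *)

Section PsdSqrt.
Context {R : realType}.

(** Induction on the nodes: a multiple of the product vanishing at the old nodes corrects the value
    at a new one. *)
Lemma interpolation (F : fieldType) (s : seq F) (f : F -> F) :
  exists p : {poly F}, forall x, x \in s -> p.[x] = f x.
Proof.
elim: s => [|y s [p hp]]; first by exists 0.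
have [ys|ys] := boolP (y \in s).
  by exists p => x; rewrite inE => /predU1P[->|]; apply: hp.
pose q := \prod_(z <- s) ('X - z%:P).
have qy : q.[y] != 0 by rewrite -rootE root_prod_XsubC.
exists (p + ((f y - p.[y]) / q.[y]) *: q) => x.
rewrite hornerD hornerZ inE => /predU1P[->|xs].
  by rewrite divfK// addrC subrK.
have /eqP -> : q.[x] == 0 by rewrite -rootE root_prod_XsubC.
by rewrite mulr0 addr0 hp.
Qed.

(** Used to see that a real polynomial in a symmetric matrix is symmetric. *)
Lemma trmx_horner m (A : 'M[R]_m.+1) (p : {poly R}) :
  (horner_mx A p)^T = horner_mx A^T p.
Proof.
elim/poly_ind: p => [|p c IH]; first by rewrite !rmorph0 trmx0.
rewrite !rmorphD !rmorphM/= !horner_mx_X !horner_mx_C linearD/= tr_scalar_mx.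
rewrite -[_ * _]/(_ *m _) trmx_mul IH; congr (_ + _).
by have := comm_horner_mx p (erefl (A^T *m A^T)).
Qed.

Lemma eigenvalue_psd_ge0 m (A : 'M[R]_m) (u : 'rV_m) (l : R) :
  psd A -> u != 0 -> u *m A = l *: u -> 0 <= l.
Proof.
move=> [_ Apos] u0 uA; have := Apos u^T.
rewrite trmxK uA -scalemxAl mxE.
have := sqr_vnorm2 _ u^T; rewrite trmxK => <-.
rewrite pmulr_lge0// exprn_gt0// lt_neqAle vnorm2_ge0 andbT eq_sym.
by apply: contra u0 => /eqP/vnorm2_eq0/(congr1 trmx); rewrite trmxK trmx0 => ->.
Qed.

(** As [A] and [l] are real, the real and imaginary parts of [u] both satisfy the eigenvector
    equation, and one of them is nonzero. This brings the complex spectral theorem back to real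
    quadratic forms. *)
Lemma complex_eigenvalue_psd_ge0 m (A : 'M[R]_m) (u : 'rV[R[i]%C]_m) (l : R) :
  psd A -> u != 0 ->
  u *m map_mx (real_complex R) A = real_complex R l *: u -> 0 <= l.
Proof.
move=> Apsd u0 uA.
have ReIm (g : R[i]%C -> R) : (forall z w, g (z + w) = g z + g w) -> g 0 = 0 ->
    (forall z r, g (z * real_complex R r) = g z * r) ->
    map_mx g u *m A = l *: map_mx g u.
  move=> gD g0 gM; apply/matrixP => i j.
  have /matrixP/(_ i j)/(congr1 g) := uA.
  rewrite !mxE mulrC gM mulrC => <-.
  by rewrite (big_morph g gD g0); apply: eq_bigr => k _; rewrite !mxE gM.
have [Re0|] := eqVneq (map_mx (@complex.Re R) u) 0; last first.
  move=> a0; apply: eigenvalue_psd_ge0 Apsd a0 _; apply: ReIm => //.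
  - by move=> [a b] [c d].
  - by move=> [a b] r /=; ring.
have [Im0|] := eqVneq (map_mx (@complex.Im R) u) 0; last first.
  move=> a0; apply: eigenvalue_psd_ge0 Apsd a0 _; apply: ReIm => //.
  - by move=> [a b] [c d].
  - by move=> [a b] r /=; ring.
case/eqP: u0; apply/matrixP => i j.
have /matrixP/(_ i j) := Re0; have /matrixP/(_ i j) := Im0; rewrite !mxE.
by case: (u i j) => a b /= -> ->.
Qed.

(** The diagonalization is complex; building the root as a real polynomial in [A] keeps it real and
    symmetric. *)
Lemma psd_sqrt_exists m (A : 'M[R]_m) : psd A ->
  exists S : 'M[R]_m, psd S /\ S *m S = A.
Proof.
(* [horner_mx] works in positive size, so the empty matrix is treated apart. *)
case: m A => [|m] A Apsd.
  exists 0; split; last by apply/matrixP => -[].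
  by split=> [|x]; rewrite ?trmx0// mulmx0 mul0mx mxE.
have Asym := proj1 Apsd.
pose f : {rmorphism R -> R[i]%C} := real_complex R; pose B : 'M[R[i]%C]_m.+1 := map_mx f A.
have Breal : B \is a mxOver Num.real.
  by apply/mxOverP => i j; rewrite mxE complex_real.
have Bherm : B \is hermsymmx.
  apply: realsym_hermsym Breal.
  have BT : B^T = B by rewrite map_trmx Asym.
  by apply/is_hermitianmxP; rewrite expr0 scale1r map_mx_id// BT.
have dreal := hermitian_spectral_diag_real Bherm.
have /orthomx_spectralP := hermitian_normalmx Bherm.
set U := spectralmx B; set d := spectral_diag B in dreal * => BE.
have Uunit : U \in unitmx by exact: spectral_unit.
pose l i : R := complex.Re (d 0 i).
have dl i : d 0 i = f (l i) by rewrite -[RHS]/(real_complex R _) RRe_real//; exact/(mxOverP dreal).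
(* Row [i] of [U] is a left eigenvector of [B = U^-1 diag(d) U] for [d_i], nonzero because [U] is
   invertible. *)
have l0 i : 0 <= l i.
  apply: (complex_eigenvalue_psd_ge0 _ _ (row i U) _ Apsd).
    apply/eqP => Ui0; have := mulmxV Uunit => /(congr1 (row i)).
    rewrite row_mul Ui0 mul0mx => /matrixP/(_ 0 i)/eqP.
    by rewrite !mxE eqxx eq_sym oner_eq0.
  rewrite -row_mul -/f -/B BE !mulmxA mulmxV// mul1mx row_mul -dl.
  by rewrite row_diag_mx -scalemxAl -rowE.
(* Fourth roots rather than square roots: for [T = p(A)] the root [T *m T] of [A] is visibly
   positive semidefinite, its form at [x] being [|T x|^2]. *)
have [p hp] := interpolation _ [seq l i | i <- enum 'I_m.+1]
  (fun x => Num.sqrt (Num.sqrt x)).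
pose T := horner_mx A p.
have Tsym : T^T = T by rewrite trmx_horner Asym.
exists (T *m T); split.
  split=> [|x]; first by rewrite trmx_mul Tsym.
  by rewrite -{1}Tsym mulmxA -trmx_mul -mulmxA -sqr_vnorm2 sqr_ge0.
have -> : T *m T *m (T *m T) = horner_mx A (p ^+ 4).
  by rewrite rmorphXn/= exprS exprS expr2 !mulmxE !mulrA.
(* Over the complex numbers [p ^+ 4] acts on each diagonal entry separately, and returns it. *)
apply: (@map_mx_inj _ _ f); rewrite map_horner_mx -/B BE.
rewrite horner_mx_uconjC// horner_mx_diag; congr (_ *m diag_mx _ *m _).
apply/matrixP => i j; rewrite ord1 mxE dl horner_map; congr (real_complex R _).
have /hp pj : l j \in [seq l i | i <- enum 'I_m.+1].
  by rewrite map_f// mem_enum.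
rewrite hornerE pj (_ : 4 = 2 * 2)%N// exprM !sqr_sqrtr ?sqrtr_ge0//.
Qed.

Lemma psd_sqrtP m (A : 'M[R]_m) : psd A ->
  psd (psd_sqrt A) /\ psd_sqrt A *m psd_sqrt A = A.
Proof.
move=> /psd_sqrt_exists[S hS].
exact: (@xgetPex _ 0 [set S | psd S /\ S *m S = A] (ex_intro _ S hS)).
Qed.

End PsdSqrt.

(** * Linearization of the least-squares estimator *)

Section Maxj.
Context {R : realType}.

Lemma maxj_ge0 m (f : 'I_m -> R) : 0 <= maxj f.
Proof. exact: bigmax_ge_id. Qed.

Lemma ler_maxj m (f : 'I_m -> R) j : f j <= maxj f.
Proof. exact: le_bigmax. Qed.

Lemma maxj_le m (f : 'I_m -> R) c : 0 <= c -> (forall j, f j <= c) -> maxj f <= c.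
Proof. by move=> c0 fc; apply: bigmax_le. Qed.

End Maxj.

Lemma invmx_mul (R : comUnitRingType) m (A B : 'M[R]_m) :
  A \in unitmx -> B \in unitmx -> invmx (A *m B) = invmx B *m invmx A.
Proof.
move=> Au Bu; have ABu : A *m B \in unitmx by rewrite unitmx_mul Au.
by rewrite -[RHS](mulKmx ABu) -mulmxA (mulmxA B) mulmxV// mul1mx mulmxV// mulmx1.
Qed.

(** Cauchy-Schwarz, with [u_j] written as the inner product of [W S^-1 e_j] and [W^-1 S u]. For
    [S = Sigma_n] and [W = V_n^{1/2}] the first vector has norm [sqrt(Omega_jj)]. *)
Lemma coord_le_whitened (R : realType) m (S W : 'M[R]_m) (u : 'cV_m) (j : 'I_m) :
  S^T = S -> W^T = W -> S \in unitmx -> W \in unitmx ->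
  `|u j 0| <= Num.sqrt ((invmx S *m (W *m W) *m invmx S) j j) *
              vnorm2 (invmx W *m S *m u).
Proof.
move=> ST WT Su Wu.
pose b := W *m invmx S *m (delta_mx j 0 : 'cV[R]_m).
have bT : b^T = delta_mx 0 j *m invmx S *m W.
  by rewrite !trmx_mul trmx_inv ST WT trmx_delta mulmxA.
have -> : u j 0 = (b^T *m (invmx W *m S *m u)) 0 0.
  by rewrite bT !mulmxA mulmxK// mulmxKV// -rowE mxE.
apply: le_trans (normr_dotv_le _ _ _) _.
rewrite ler_wpM2r ?vnorm2_ge0// vnorm2_def ler_wsqrtr//.
rewrite bT /b !mulmxA -colE -!mulmxA -rowE !mulmxA.
by rewrite [leLHS]mxE mxE.
Qed.

Section Remainder.
Context {R : realType}.
Variables (m : nat) (Sg W : 'M[R]_m).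
Hypotheses (SgT : Sg^T = Sg) (WT : W^T = W).
Hypotheses (Sgu : Sg \in unitmx) (Wu : W \in unitmx).

(** With [y = Sg e] and [x = Sg p] the equation becomes [y - x = - M y], so
    [|y - x| <= D |y| <= 2 D |x|]. Passing between these coordinates and those whitened by [W] costs
    the norms of [K = Sg^-1 W] and of its inverse, whose product is the condition number. *)
Lemma whitened_remainder_bound (Sh : 'M[R]_m) (e p : 'cV_m) :
  let D := opnorm (invmx Sg *m Sh *m invmx Sg - 1%:M) in
  D <= 2^-1 -> Sh *m e = Sg *m Sg *m p ->
  vnorm2 (invmx W *m (Sg *m Sg) *m (e - p)) <=
  2 * cond_num (invmx Sg *m W) * (D * vnorm2 (invmx W *m (Sg *m Sg) *m p)).
Proof.
set M := _ - 1%:M => D D2 Shep.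
pose y := Sg *m e; pose x := Sg *m p.
have Dge0 : 0 <= D := opnorm_ge0 _ _.
have yxM : y - x = - (M *m y).
  rewrite /M mulmxBl mul1mx opprB; congr (_ - _).
  by rewrite /y mulmxA mulmxKV// -mulmxA Shep /x -mulmxA mulKmx.
have yx_le : vnorm2 (y - x) <= D * vnorm2 y by rewrite yxM vnorm2N vnorm2_opnorm.
(* [|y| <= |y - x| + |x| <= |y| / 2 + |x|], by [D <= 1/2]. *)
have y_le : vnorm2 y <= 2 * vnorm2 x.
  have : vnorm2 y <= vnorm2 (y - x) + vnorm2 x by rewrite -{1}(subrK x y) ler_vnorm2D.
  have := vnorm2_ge0 _ y; nra.
pose K := invmx Sg *m W.
have KV : invmx K = invmx W *m Sg by rewrite /K invmx_mul ?invmxK// unitmx_inv.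
have -> : invmx W *m (Sg *m Sg) *m (e - p) = invmx K *m (y - x).
  by rewrite KV /y /x -mulmxBr !mulmxA.
have x_le : vnorm2 x <= opnorm K * vnorm2 (invmx W *m (Sg *m Sg) *m p).
  have -> : x = K *m (invmx W *m (Sg *m Sg) *m p).
    by rewrite /K !mulmxA mulmxK// mulVmx// mul1mx.
  exact: vnorm2_opnorm.
apply: le_trans (vnorm2_opnorm _ _ _) _; rewrite /cond_num -/K.
have K0 := opnorm_ge0 _ K; have KV0 := opnorm_ge0 _ (invmx K).
have -> : forall a b d w : R, 2 * (a * b) * (d * w) = a * (d * (2 * (b * w))).
  by move=> *; ring.
rewrite ler_wpM2l//; apply: le_trans yx_le _; rewrite ler_wpM2l//.
by apply: le_trans y_le _; rewrite ler_wpM2l.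
Qed.

Let Sig := Sg *m Sg.
Let V := W *m W.

(** A kernel vector of [Sh] would give [M y = - y] with [|M y| <= |y| / 2], which forces [y = 0]. *)
Lemma whitened_unitmx (Sh : 'M[R]_m) :
  opnorm (invmx Sg *m Sh *m invmx Sg - 1%:M) <= 2^-1 -> Sh \in unitmx.
Proof.
set M := _ - 1%:M => D2; rewrite -[Sh]trmxK unitmx_tr -row_free_unit.
apply/inj_row_free => v vSh.
have Shv : Sh *m v^T = 0 by rewrite -[Sh]trmxK -trmx_mul vSh trmx0.
pose y := Sg *m v^T.
have My : M *m y = - y.
  by rewrite /M mulmxBl mul1mx /y mulmxA mulmxKV// -mulmxA Shv mulmx0 sub0r.
have := vnorm2_opnorm _ M y; rewrite My vnorm2N => y_le.
have y0 : vnorm2 y = 0 by have := vnorm2_ge0 _ y; nra.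
rewrite -[v]trmxK -[v^T](mulKmx Sgu) -/y (vnorm2_eq0 _ y y0).
by rewrite mulmx0 trmx0.
Qed.

Lemma wnorm_sqrt (p : 'cV[R]_m) :
  wnorm (Sig *m invmx V *m Sig) p = vnorm2 (invmx W *m Sig *m p).
Proof.
rewrite /wnorm vnorm2_def !trmx_mul trmx_inv WT SgT /V invmx_mul//.
by rewrite !mulmxA.
Qed.

End Remainder.

Section Estimator.
Context {R : realType} {dT : measure_display} {T : measurableType dT}.
Variables (P : probability T R) (n m : nat).
Variables (X : 'I_n -> T -> 'cV[R]_m) (Y : 'I_n -> T -> R).

(** Both sides are the average of [X_i (Y_i - X_i^T beta)]; the identity is exact, the linearization
    error being due only to [Sigma_hat] replacing [Sigma_n] on the left. *)
Lemma normal_equations w :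
  Sigma_n P X \in unitmx -> Sigma_hat X w \in unitmx ->
  Sigma_hat X w *m (beta_hat X Y w - beta_n P X Y) =
  Sigma_n P X *m psi_bar P X Y w.
Proof.
move=> Su Shu; rewrite mulmxBr /beta_hat mulKVmx// /psi_bar -scalemxAr mulmx_sumr.
rewrite /Gamma_hat /Sigma_hat -scalemxAl mulmx_suml -scalerBr -sumrB.
congr (_ *: _); apply: eq_bigr => i _.
rewrite /psi -scalemxAr mulKVmx// /resid scalerBl -mulmxA.
by rewrite -(mul_mx_scalar (((X i w)^T *m _) 0 0)) -mx11_scalar.
Qed.

(** With [v = b / sqrt o], [u = (a - b) / sqrt o] and [r = sqrt (o / oh)], the difference is
    [(v + u) (r - 1) + u], where [|v| <= s], [|u| <= 2 k eta] and [|r - 1| <= eta]. *)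
Lemma studentized_coord (a b o oh k w eta s : R) : 0 < o -> 0 < oh -> 0 <= k ->
  `|a - b| <= Num.sqrt o * w -> w <= 2 * k * eta ->
  `|Num.sqrt (o / oh) - 1| <= eta -> `|b / Num.sqrt o| <= s ->
  `|a / Num.sqrt oh - b / Num.sqrt o| <=
  2 * k * eta + 2 * k * eta * eta + s * eta.
Proof.
move=> o0 oh0 k0 ab w_le r_le b_le.
have so0 : 0 < Num.sqrt o by rewrite sqrtr_gt0.
have soh0 : 0 < Num.sqrt oh by rewrite sqrtr_gt0.
have eta0 : 0 <= eta := le_trans (normr_ge0 _) r_le.
have rE : Num.sqrt (o / oh) = Num.sqrt o / Num.sqrt oh.
  by rewrite sqrtrM ?ltW// sqrtrV ?ltW.
rewrite rE in r_le; set r := _ / _ in r_le.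
pose u := (a - b) / Num.sqrt o; set v := b / Num.sqrt o in b_le *.
have u_le : `|u| <= 2 * k * eta.
  rewrite normrM normfV (gtr0_norm so0) ler_pdivrMr// mulrC.
  by apply: le_trans ab _; rewrite ler_wpM2l// ltW.
have -> : a / Num.sqrt oh - v = (v + u) * (r - 1) + u.
  by rewrite /u /v /r; field; rewrite !gt_eqF.
apply: le_trans (ler_normD _ _) _; rewrite normrM.
have vu : `|v + u| <= s + 2 * k * eta by apply: le_trans (ler_normD _ _) _; exact: lerD.
have : `|v + u| * `|r - 1| <= (s + 2 * k * eta) * eta by rewrite ler_pM.
lra.
Qed.

Variable Omega_hat : T -> 'M[R]_m.

Let Tstat w := maxj (fun j =>
  `|(beta_hat X Y w j 0 - beta_n P X Y j 0) / Num.sqrt (Omega_hat w j j)|).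
Let Sstat w := maxj (fun j =>
  `|psi_bar P X Y w j 0 / Num.sqrt (Omega_n P X Y j j)|).

(** Deterministic, at a fixed outcome [w]: the coordinatewise bound passes to the maxima because
    [maxj] is 1-Lipschitz for the sup norm. *)
Lemma studentized_max_close (eta : R) w :
  0 < eta ->
  psd (Sigma_n P X) -> Sigma_n P X \in unitmx ->
  psd (V_n P X Y) -> V_n P X Y \in unitmx ->
  (forall j, 0 < Omega_n P X Y j j) -> (forall j, 0 < Omega_hat w j j) ->
  event_E P X Y Omega_hat eta w ->
  Sstat w <= Num.sqrt (2 * ln (2 * n%:R)) ->
  `|Tstat w - Sstat w| <= C_n P X Y eta * eta.
Proof.
move=> eta0 Spsd Su Vpsd Vu O0 Oh0 [[/= D2 Dw] /= Ome] Ss.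
have [[SgT _] SgE] := psd_sqrtP _ _ Spsd.
have [[WT _] WE] := psd_sqrtP _ _ Vpsd.
have Sgu : psd_sqrt (Sigma_n P X) \in unitmx.
  by move: Su; rewrite -{1}SgE unitmx_mul => /andP[].
have Wu : psd_sqrt (V_n P X Y) \in unitmx.
  by move: Vu; rewrite -{1}WE unitmx_mul => /andP[].
have ST : (Sigma_n P X)^T = Sigma_n P X := proj1 Spsd.
have Shu := whitened_unitmx _ _ Sgu _ D2.
pose e := beta_hat X Y w - beta_n P X Y; pose p := psi_bar P X Y w.
have Shep : Sigma_hat X w *m e =
    psd_sqrt (Sigma_n P X) *m psd_sqrt (Sigma_n P X) *m p.
  by rewrite SgE normal_equations.
have := whitened_remainder_bound _ _ _ Sgu Wu _ _ _ D2 Shep.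
(* The weighted norm in [event_E] is the whitened norm of [psi_bar], so the event bounds the
   remainder by [2 kappa eta]. *)
rewrite -[X in _ <= _ * (_ * X)]wnorm_sqrt// SgE WE => u_le.
set w0 := vnorm2 _ in u_le.
have k0 : 0 <= kappa_n P X Y := cond_num_ge0 _ _.
have w0_le : w0 <= 2 * kappa_n P X Y * eta.
  apply: le_trans u_le _; rewrite ler_wpM2l//.
  exact: mulr_ge0.
have coord j : `|(e - p) j 0| <= Num.sqrt (Omega_n P X Y j j) * w0.
  have := coord_le_whitened _ _ _ _ (e - p) j ST WT Su Wu.
  by rewrite WE.
pose s : R := Num.sqrt (2 * ln (2 * n%:R)).
have CE : C_n P X Y eta * eta = 2 * kappa_n P X Y * eta +
    2 * kappa_n P X Y * eta * eta + s * eta by rewrite /C_n -/s; ring.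
pose a j := (beta_hat X Y w j 0 - beta_n P X Y j 0) / Num.sqrt (Omega_hat w j j).
pose b j := psi_bar P X Y w j 0 / Num.sqrt (Omega_n P X Y j j).
have aT j : `|a j| <= Tstat w by exact: (ler_maxj _ (fun j => `|a j|)).
have bS j : `|b j| <= Sstat w by exact: (ler_maxj _ (fun j => `|b j|)).
have close j : `|(beta_hat X Y w j 0 - beta_n P X Y j 0) / Num.sqrt (Omega_hat w j j)
     - psi_bar P X Y w j 0 / Num.sqrt (Omega_n P X Y j j)| <= C_n P X Y eta * eta.
  rewrite CE; apply: (@studentized_coord _ _ (Omega_n P X Y j j) _ _ w0) => //.
  - by have := coord j; rewrite /e /p !mxE.
  - apply: le_trans Ome.
    exact: (ler_maxj _ (fun j => `|Num.sqrt (Omega_n P X Y j j / Omega_hat w j j) - 1|)).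
  - exact: le_trans (bS j) Ss.
have C0 : 0 <= C_n P X Y eta * eta.
  have s0 : 0 <= s := sqrtr_ge0 _.
  have ke0 : 0 <= kappa_n P X Y * eta by apply: mulr_ge0 => //; exact: ltW.
  by rewrite CE; nra.
rewrite ler_distl lerBlDr; apply/andP; split; apply: maxj_le;
  rewrite ?addr_ge0 ?maxj_ge0// => j.
- have := lerB_dist (b j) (a j); rewrite distrC.
  by move: (aT j) (close j); rewrite -/(a j) -/(b j); lra.
- have := lerB_dist (a j) (b j).
  by move: (bS j) (close j); rewrite -/(a j) -/(b j); lra.
Qed.

End Estimator.

(** * Moments and Gaussian vectors *)

Lemma quadE (R : pzRingType) m (A : 'M[R]_m) (x y : 'cV_m) :
  (x^T *m A *m y) 0 0 = \sum_a \sum_b x a 0 * A a b * y b 0.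
Proof.
rewrite exchange_big/= mxE; apply: eq_bigr => b _; rewrite mxE mulr_suml.
by apply: eq_bigr => a _; rewrite mxE.
Qed.

Lemma quad_delta (R : comPzRingType) m (A : 'M[R]_m) j :
  ((delta_mx j 0 : 'cV_m)^T *m A *m (delta_mx j 0 : 'cV_m)) 0 0 = A j j.
Proof. by rewrite trmx_delta -rowE -colE !mxE. Qed.

Lemma quadC (R : comPzRingType) m (A : 'M[R]_m) (x y : 'cV_m) :
  A^T = A -> (x^T *m A *m y) 0 0 = (y^T *m A *m x) 0 0.
Proof.
move=> AT; rewrite !quadE exchange_big/=; apply: eq_bigr => b _.
by apply: eq_bigr => a _; rewrite -{1}AT mxE; ring.
Qed.

Lemma quad_line (R : comPzRingType) m (A : 'M[R]_m) (x y : 'cV_m) (t : R) :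
  A^T = A -> ((x + t *: y)^T *m A *m (x + t *: y)) 0 0 =
  (x^T *m A *m x) 0 0 + 2 * (x^T *m A *m y) 0 0 * t + (y^T *m A *m y) 0 0 * t ^+ 2.
Proof.
move=> AT.
have -> : 2 * (x^T *m A *m y) 0 0 = (x^T *m A *m y) 0 0 + (y^T *m A *m x) 0 0.
  by rewrite (quadC _ _ _ y x AT); ring.
rewrite !quadE -!big_split/= !mulr_suml -!big_split/=.
apply: eq_bigr => a _; rewrite -!big_split/= !mulr_suml -!big_split/=.
by apply: eq_bigr => b _; rewrite !mxE; ring.
Qed.

Section Moments.
Context {R : realType} {dT : measure_display} {T : measurableType dT}.
Variable P : probability T R.

Lemma Er_ge0 (f : T -> R) : (forall w, 0 <= f w) -> 0 <= Er P f.
Proof.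
by move=> f0; rewrite /Er unlock; apply: Rintegral_ge0 => w _; exact: f0.
Qed.

Lemma Er_sum (I : Type) (s : seq I) (f : I -> T -> R) :
  (forall i, P.-integrable [set: T] (EFin \o f i)) ->
  Er P (fun w => \sum_(i <- s) f i w) = \sum_(i <- s) Er P (f i).
Proof.
move=> fint; rewrite /Er unlock.
under eq_integral do rewrite -sumEFin.
rewrite (integral_sum measurableT fint s xpredT) -sum_fine// => i _.
exact: integrable_fin_num.
Qed.

Lemma ErZ (a : R) (f : T -> R) : P.-integrable [set: T] (EFin \o f) ->
  Er P (fun w => a * f w) = a * Er P f.
Proof. by move=> fint; rewrite /Er unlock; exact: RintegralZl. Qed.

(** Domination by [|f g| <= f^2 + g^2]. *)
Lemma integrable_mul_sqr (f g : T -> R) :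
  measurable_fun [set: T] f -> measurable_fun [set: T] g ->
  P.-integrable [set: T] (fun w => (f w ^+ 2)%:E) ->
  P.-integrable [set: T] (fun w => (g w ^+ 2)%:E) ->
  P.-integrable [set: T] (EFin \o (fun w => f w * g w)).
Proof.
move=> mf mg f2 g2.
apply: (le_integrable measurableT _ _ (integrableD measurableT f2 g2)).
  by apply/measurable_EFinP; exact: measurable_funM.
move=> w _ /=; rewrite lee_fin (ger0_norm (addr_ge0 (sqr_ge0 _) (sqr_ge0 _))).
rewrite normrM -[f w ^+ 2]real_normK ?num_real// -[g w ^+ 2]real_normK ?num_real//.
by have := sqr_ge0 (`|f w| - `|g w|); nra.
Qed.

(** The form at [x] is the average of [E[(x^T X_i)^2]]; second moments make every product
    integrable, so the square may be expanded under the expectation. *)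
Lemma Sigma_n_psd (n m : nat) (X : 'I_n -> T -> 'cV[R]_m) :
  (forall i a, measurable_fun [set: T] (fun w => X i w a 0)) ->
  (forall i a, P.-integrable [set: T] (fun w => (X i w a 0 ^+ 2)%:E)) ->
  psd (Sigma_n P X).
Proof.
move=> mX X2; split=> [|x].
  apply/matrixP => a b; rewrite /Sigma_n !mxE !summxE; congr (_ * _).
  apply: eq_bigr => i _; rewrite !mxE; congr (Er P _).
  by apply/funext => w; rewrite mulrC.
rewrite /Sigma_n -scalemxAr -scalemxAl mxE mulr_ge0 ?invr_ge0 ?ler0n//.
rewrite mulmx_sumr mulmx_suml summxE; apply: sumr_ge0 => i _; rewrite quadE.
have XX a b := integrable_mul_sqr _ _ (mX i a) (mX i b) (X2 i a) (X2 i b).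
have xXX a b : P.-integrable [set: T] (EFin \o
    (fun w => x a 0 * x b 0 * (X i w a 0 * X i w b 0))).
  exact: (integrableZl measurableT (x a 0 * x b 0) (XX a b)).
have -> : \sum_a \sum_b x a 0 * (\matrix_(c, d) Er P (fun w => X i w c 0 * X i w d 0)) a b
     * x b 0 = Er P (fun w => (\sum_a x a 0 * X i w a 0) ^+ 2).
  transitivity (Er P (fun w => \sum_a \sum_b
      x a 0 * x b 0 * (X i w a 0 * X i w b 0))).
    rewrite Er_sum => [|a]; last first.
      have := integrable_sum measurableT (index_enum _) (P := xpredT) (fun b _ => xXX a b).
      by apply: eq_integrable => // w _ /=; rewrite sumEFin.
    apply: eq_bigr => a _; rewrite Er_sum; last exact: xXX.
    by apply: eq_bigr => b _; rewrite ErZ// mxE mulrAC.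
  congr (Er P _); apply/funext => w; rewrite expr2 mulr_suml.
  apply: eq_bigr => a _; rewrite mulr_sumr; apply: eq_bigr => b _.
  by rewrite mulrACA.
by apply: Er_ge0 => w; rewrite sqr_ge0.
Qed.

(** The factors commute pointwise under [Er], so symmetry holds even where an entry is a junk
    value. *)
Lemma varmx_sym m (Z : T -> 'cV[R]_m) : (varmx P Z)^T = varmx P Z.
Proof.
apply/matrixP => a b; rewrite !mxE; congr (Er P _).
by apply/funext => w; rewrite mulrC.
Qed.

End Moments.

(** * Tail and atoms of the normal law *)

Section GaussianTail.
Context {R : realType}.

Lemma normal_prob_tail (s : R) : 0 <= s ->
  (normal_prob 0 1 `]s, +oo[ <= (expR (- s ^+ 2 / 2))%:E)%E.
Proof.
move=> s0; rewrite /normal_prob.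
(* Chernoff bound, by comparison with the density shifted by s. *)
have pdf_le (x : R) : s < x ->
    normal_pdf 0 1 x <= expR (- s ^+ 2 / 2) * normal_pdf s 1 x.
  move=> sx; rewrite !normal_pdfE ?oner_neq0// mulrCA ler_wpM2l ?normal_peak_ge0//.
  rewrite /normal_fun -expRD ler_expR subr0 expr1n.
  have -> : (1 : R) *+ 2 = 2 by [].
  (* The two exponents differ by [s (x - s) >= 0]. *)
  by nra.
have mpdf a : measurable_fun [set: R] (fun x => (normal_pdf a 1 x)%:E).
  by apply/measurable_EFinP; exact: measurable_normal_pdf.
have mscaled c : measurable_fun [set: R] (fun x => (c * normal_pdf s 1 x)%:E).
  by apply/measurable_EFinP; apply: measurable_funM => //; exact: measurable_normal_pdf.
apply: (@le_trans _ _ (\int[lebesgue_measure]_(x in `]s, +oo[)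
    (expR (- s ^+ 2 / 2) * normal_pdf s 1 x)%:E)%E).
  apply: ge0_le_integral => //=.
  - by move=> x _; rewrite lee_fin normal_pdf_ge0.
  - exact: (measurable_funTS (mpdf 0)).
  - apply: measurable_funTS; exact: (mscaled (expR (- s ^+ 2 / 2))).
  - by move=> x; rewrite in_itv/= andbT => sx; rewrite lee_fin pdf_le.
under eq_integral do rewrite EFinM.
rewrite ge0_integralZl//=; last 2 first.
- exact: (measurable_funTS (mpdf s)).
- by move=> x _; rewrite lee_fin normal_pdf_ge0.
(* The shifted density has total mass 1, hence mass at most 1 on the half-line. *)
rewrite -[leRHS]mule1 lee_pmul2l ?lte_fin ?expR_gt0// -(integral_normal_pdf s 1).
apply: ge0_subset_integral => //= [|x _]; first exact: mpdf.
by rewrite lee_fin normal_pdf_ge0.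
Qed.

Lemma normal_prob_set1 (a s : R) : normal_prob 0 s [set a] = 0%E.
Proof.
by rewrite /normal_prob integral_set1.
Qed.

End GaussianTail.

Section GaussianVector.
Context {R : realType} {dT : measure_display} {T : measurableType dT}.
Variables (P : probability T R) (m : nat) (G : T -> 'cV[R]_m) (S : 'M[R]_m).
Hypothesis GS : gaussian_vector P G S.

Lemma measurable_gaussian_lin (a : 'cV[R]_m) :
  measurable_fun [set: T] (fun w => (a^T *m G w) 0 0).
Proof.
under eq_fun do rewrite dotvE.
apply: measurable_sum => j; apply: measurable_funM => //.
exact: (proj1 GS).
Qed.

(** A normal law of positive variance has no atoms. *)
Lemma gaussian_coord_eq0 j : 0 < S j j -> P [set w | G w j 0 = 0] = 0%E.
Proof.
move=> Sj; have := proj2 GS (delta_mx j 0); rewrite /= quad_delta => -[h _].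
have := h Sj _ (measurable_set1 (0 : R)); rewrite normal_prob_set1 => <-.
congr (P _); apply/seteqP; split => w; rewrite /= trmx_delta -rowE mxE inE//.
Qed.

(* On a line through e_j along which the form becomes negative, the form has
   two zeros; the corresponding combinations vanish a.s., hence so does G_j. *)
Lemma gaussian_psd : S^T = S -> (forall j, 0 < S j j) -> psd S.
Proof.
move=> ST S0; split=> // x; rewrite leNgt; apply/negP => x_lt0.
(* Any index will do; in dimension 0 the form is an empty sum, hence not negative. *)
have [j _|m0] := pickP [pred j : 'I_m | true]; last first.
  move: x_lt0; rewrite quadE big1 ?ltxx// => a _.
  by have := m0 a.
pose e : 'cV[R]_m := delta_mx j 0.
pose c := (x^T *m S *m x) 0 0; pose b := (e^T *m S *m x) 0 0.
have eSe : (e^T *m S *m e) 0 0 = S j j by exact: quad_delta.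
have c_lt0 : c < 0 by [].
have disc : 0 < b ^+ 2 - c * S j j.
  by rewrite subr_gt0 (lt_le_trans _ (sqr_ge0 b))// nmulr_rlt0.
pose r := Num.sqrt (b ^+ 2 - c * S j j).
have r0 : 0 < r by rewrite sqrtr_gt0.
have r2 : r ^+ 2 = b ^+ 2 - c * S j j by rewrite sqr_sqrtr// ltW.
have c0 : c != 0 by rewrite lt_eqF.
have mlin (a : 'cV[R]_m) : measurable [set w | (a^T *m G w) 0 0 = 0].
  rewrite -[X in measurable X]setTI.
  exact: (measurable_gaussian_lin a measurableT [set 0] (measurable_set1 _)).
(* The zeros of [S_jj + 2 b t + c t^2], the form at [e + t x], are [t = (s - b) / c] with [s = r] or
   [s = - r]. *)
have root (s : R) : s ^+ 2 = r ^+ 2 ->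
    P (~` [set w | ((e + ((s - b) / c) *: x)^T *m G w) 0 0 = 0]) = 0%E.
  move=> sr; rewrite probability_setC; last exact: mlin.
  rewrite (proj2 (proj2 GS _)) ?subee//.
  rewrite quad_line// eSe -/b -/c.
  apply: (mulfI c0); rewrite mulr0.
  have -> : forall q : R, c * (S j j + 2 * b * (q / c) + c * (q / c) ^+ 2) =
      c * S j j + 2 * b * q + q ^+ 2 by move=> q; field.
  by move: r2; rewrite -sr; lra.
have N1 := root r erefl; have N2 := root (- r) (sqrrN r).
have := gaussian_coord_eq0 j (S0 j).
set E0 := [set w | G w j 0 = 0] => PE0.
set E1 := ~` _ in N1; set E2 := ~` _ in N2.
have mE0 : measurable E0.
  rewrite -[X in measurable X]setTI.
  exact: (proj1 GS j measurableT [set 0] (measurable_set1 _)).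
(* Where both combinations vanish, their difference gives [x^T G = 0] and then [G_j = 0]; three null
   sets would thus cover the whole space. *)
have cover : setT `<=` E0 `|` (E1 `|` E2).
  move=> w _; have [w1|] := pselect (E1 w); first by right; left.
  have [w2 _|] := pselect (E2 w); first by right; right.
  move=> /contrapT w2 /contrapT w1; left.
  have dotDZ t : ((e + t *: x)^T *m G w) 0 0 = G w j 0 + t * (x^T *m G w) 0 0.
    rewrite !dotvE mulr_sumr (bigD1 j)//= [in RHS](bigD1 j)//= !mxE !eqxx/=.
    rewrite mulrDl mul1r mulrA addrA; congr (_ + _).
    by apply: eq_bigr => i /negPf ij; rewrite !mxE ij add0r mulrA.
  rewrite /= in w1 w2; rewrite /E0 /=.
  move: w1 w2; rewrite !dotDZ.
  set g := (_ *m _) 0 0 => w1 w2.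
  have : (2 * r / c) * g = 0.
    have -> : 2 * r / c * g = (G w j 0 + (r - b) / c * g) - (G w j 0 + (- r - b) / c * g).
      by field.
    by rewrite w1 w2 subrr.
  move=> /eqP; rewrite !mulf_eq0 invr_eq0 (negPf c0) (gt_eqF r0) pnatr_eq0/=.
  by move=> /eqP g0; move: w1; rewrite g0 mulr0 addr0.
have := @probability_setT _ _ _ P; apply/eqP; rewrite lt_eqF//.
apply: (@le_lt_trans _ _ (P E0 + (P E1 + P E2))%E); last by rewrite PE0 N1 N2 !adde0 lte01.
have mE1 : measurable E1 by apply: measurableC.
have mE2 : measurable E2 by apply: measurableC.
apply: le_trans (le_measure _ _ _ cover) _; rewrite ?inE//.
  by apply: measurableU => //; apply: measurableU.
apply: le_trans (measureU2 _ _ _) _ => //; first exact: measurableU.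
by rewrite leeD2l// measureU2.
Qed.

End GaussianVector.

(** * Measurability *)

Section RationalVectors.
Context {R : realType}.

Lemma rational_approx m (x : 'cV[R]_m) (e : R) : 0 < e ->
  exists q : 'cV[rat]_m, vnorm2 (map_mx ratr q - x) <= e * Num.sqrt m%:R.
Proof.
move=> e0.
have h a : exists q : rat, x a 0 < ratr q < x a 0 + e.
  have [|q] := @rat_in_itvoo R (x a 0) (x a 0 + e); first by rewrite ltrDl.
  by rewrite in_itv/= => hq; exists q.
have [f hf] := choice h.
exists (\col_a f a); rewrite -[e]gtr0_norm// -sqrtr_sqr -sqrtrM ?sqr_ge0//.
rewrite /vnorm2 ler_wsqrtr// mulr_natr -[X in _ *+ X](card_ord m) -sumr_const.
apply: ler_sum => a _; rewrite !mxE.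
by have /andP[] := hf a; nra.
Qed.

(** Reduces the bound to countably many vectors, which is what measurability of [opnorm] needs. *)
Lemma opnorm_le_rational m (A : 'M[R]_m) (c : R) : 0 <= c ->
  (forall q : 'cV[rat]_m, vnorm2 (A *m map_mx ratr q) <=
    c * vnorm2 (map_mx ratr q : 'cV[R]_m)) ->
  opnorm A <= c.
Proof.
move=> c0 hq; apply/(opnorm_leP _ _ _ c0) => x.
pose K := (c + opnorm A) * Num.sqrt m%:R.
have K0 : 0 <= K by rewrite mulr_ge0 ?addr_ge0 ?opnorm_ge0 ?sqrtr_ge0.
apply/ler_addgt0Pr => e e0.
(* This precision makes the approximation error [(c + opnorm A) |y - x|] at most
   [e K / (K + 1) <= e]; the added 1 covers [K = 0]. *)
have eK0 : 0 < e / (K + 1) by rewrite divr_gt0// ltr_wpDl.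
have [q] := rational_approx _ x _ eK0.
set y : 'cV[R]_m := map_mx ratr q => hy.
have := hq q; rewrite -/y => Ay.
have Ax : vnorm2 (A *m x) <= vnorm2 (A *m y) + opnorm A * vnorm2 (y - x).
  rewrite -[vnorm2 (y - x)]vnorm2N opprB.
  apply: le_trans _ (lerD (lexx _) (vnorm2_opnorm _ _ _)).
  by rewrite -{1}(subrKC y x) mulmxDr ler_vnorm2D.
have yx : vnorm2 y <= vnorm2 x + vnorm2 (y - x).
  by rewrite -{1}(subrKC x y) ler_vnorm2D.
have oA := opnorm_ge0 _ A.
have s0 := sqrtr_ge0 (m%:R : R).
have : (c + opnorm A) * vnorm2 (y - x) <= e.
  apply: le_trans (ler_wpM2l _ hy) _; first exact: addr_ge0.
  rewrite mulrCA -/K mulrAC -mulrA ler_piMr ?(ltW e0)// ler_pdivrMr ?ltr_wpDl//.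
  lra.
have := ler_wpM2l c0 yx; lra.
Qed.

End RationalVectors.

Section Measurability.
Context {R : realType} {dT : measure_display} {T : measurableType dT}.

Definition measurable_mx p q (A : T -> 'M[R]_(p, q)) :=
  forall i j, measurable_fun [set: T] (fun w => A w i j).

Lemma measurable_sqrtr (f : T -> R) :
  measurable_fun [set: T] f -> measurable_fun [set: T] (fun w => Num.sqrt (f w)).
Proof.
move=> mf; apply: (@measurableT_comp _ _ _ _ _ _ (@Num.sqrt R)) mf.
by apply: continuous_measurable_fun; exact: sqrt_continuous.
Qed.

(** Uses [x^-1 = x (x^2)^-1], with a real power of the nonnegative [x^2]; at [x = 0] both sides are
    0. *)
Lemma measurable_invr (f : T -> R) :
  measurable_fun [set: T] f -> measurable_fun [set: T] (fun w => (f w)^-1).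
Proof.
move=> mf; have -> : (fun w => (f w)^-1) = (fun w => f w * (f w ^+ 2) `^ (-1)).
  apply/funext => w; rewrite powR_inv1 ?sqr_ge0//.
  have [->|f0] := eqVneq (f w) 0; first by rewrite invr0 mul0r.
  by field.
apply: measurable_funM => //.
apply: (@measurableT_comp _ _ _ _ _ _ (@powR R ^~ (-1))).
  exact: measurable_powR.
exact: measurable_funX.
Qed.

Lemma measurable_maxj m (f : 'I_m -> T -> R) :
  (forall j, measurable_fun [set: T] (f j)) ->
  measurable_fun [set: T] (fun w => maxj (fun j => f j w)).
Proof.
move=> mf; rewrite /maxj; elim: (index_enum _) => [|j s IH].
  by under eq_fun do rewrite big_nil; exact: measurable_cst.
by under eq_fun do rewrite big_cons; exact: measurable_maxr.
Qed.

Lemma measurable_mulmx p q r (A : T -> 'M[R]_(p, q)) (B : T -> 'M[R]_(q, r)) :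
  measurable_mx _ _ A -> measurable_mx _ _ B ->
  measurable_mx _ _ (fun w => A w *m B w).
Proof.
move=> mA mB i j; under eq_fun do rewrite mxE.
by apply: measurable_sum => k; exact: measurable_funM.
Qed.

Lemma measurable_addmx p q (A B : T -> 'M[R]_(p, q)) :
  measurable_mx _ _ A -> measurable_mx _ _ B ->
  measurable_mx _ _ (fun w => A w + B w).
Proof.
by move=> mA mB i j; under eq_fun do rewrite mxE; exact: measurable_funD.
Qed.

Lemma measurable_summx p q (I : Type) (s : seq I) (A : I -> T -> 'M[R]_(p, q)) :
  (forall k, measurable_mx _ _ (A k)) ->
  measurable_mx _ _ (fun w => \sum_(k <- s) A k w).
Proof.
move=> mA i j; under eq_fun do rewrite summxE.
by apply: measurable_sum => k; exact: mA.
Qed.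

Lemma measurable_scalemx p q (f : T -> R) (A : T -> 'M[R]_(p, q)) :
  measurable_fun [set: T] f -> measurable_mx _ _ A ->
  measurable_mx _ _ (fun w => f w *: A w).
Proof.
by move=> mf mA i j; under eq_fun do rewrite mxE; exact: measurable_funM.
Qed.

Lemma measurable_cstmx p q (A : 'M[R]_(p, q)) : measurable_mx _ _ (fun=> A).
Proof. by move=> i j; exact: measurable_cst. Qed.

Lemma measurable_trmx p q (A : T -> 'M[R]_(p, q)) :
  measurable_mx _ _ A -> measurable_mx _ _ (fun w => (A w)^T).
Proof. by move=> mA i j; under eq_fun do rewrite mxE; exact: mA. Qed.

Lemma measurable_det m (A : T -> 'M[R]_m) :
  measurable_mx _ _ A -> measurable_fun [set: T] (fun w => \det (A w)).
Proof.
move=> mA; apply: measurable_sum => s; apply: measurable_funM => //.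
by apply: measurable_prod => i _; exact: mA.
Qed.

(** [invmx] returns a singular matrix unchanged, hence the split on the determinant; elsewhere the
    entries are given by cofactors. *)
Lemma measurable_invmx m (A : T -> 'M[R]_m) :
  measurable_mx _ _ A -> measurable_mx _ _ (fun w => invmx (A w)).
Proof.
move=> mA i j; have mdet := measurable_det _ _ mA.
have -> : (fun w => invmx (A w) i j) = (fun w => if \det (A w) == 0 then A w i j
    else (\det (A w))^-1 * cofactor (A w) j i).
  apply/funext => w; rewrite /invmx unitmxE unitfE.
  by case: eqVneq => //= _; rewrite !mxE.
apply: measurable_fun_ifT => //.
- by apply: measurable_fun_eqr => //; exact: measurable_cst.
- apply: measurable_funM; first exact: measurable_invr.
  apply: measurable_funM => //; apply: measurable_det => k l.
  by under eq_fun do rewrite !mxE; exact: mA.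
Qed.

Lemma measurable_vnorm2 m (x : T -> 'cV[R]_m) :
  measurable_mx _ _ x -> measurable_fun [set: T] (fun w => vnorm2 (x w)).
Proof.
move=> mx; apply: measurable_sqrtr; apply: measurable_sum => a.
by apply: measurable_funX; exact: mx.
Qed.

Lemma measurable_set_ler (f g : T -> R) :
  measurable_fun [set: T] f -> measurable_fun [set: T] g ->
  measurable [set w | f w <= g w].
Proof.
move=> mf mg; rewrite -[X in measurable X]setTI.
exact: measurable_fun_le.
Qed.

Lemma measurable_opnorm m (A : T -> 'M[R]_m) :
  measurable_mx _ _ A -> measurable_fun [set: T] (fun w => opnorm (A w)).
Proof.
move=> mA; apply: (measurability _ (RGenOInfty.measurableE R)).
move=> _ [_ [c ->] <-]; rewrite setTI.
have [c0|c0] := ltP c 0.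
  rewrite [X in measurable X](_ : _ = setT)//; apply/seteqP; split => // w _ /=.
  by rewrite in_itv/= andbT (lt_le_trans c0)// opnorm_ge0.
(* The rational vectors are enumerated by [unpickle]; codes of no vector impose no condition. *)
pose F k : set T := if unpickle k is Some q then [set w |
  vnorm2 (A w *m map_mx ratr (q : 'cV[rat]_m)) <= c * vnorm2 (map_mx ratr q : 'cV[R]_m)]
  else setT.
rewrite [X in measurable X](_ : _ = ~` \bigcap_k F k).
  apply: measurableC; apply: bigcapT_measurable => k; rewrite /F.
  case: unpickle => [q|]; last exact: measurableT.
  apply: measurable_set_ler; last exact: measurable_cst.
  by apply: measurable_vnorm2; apply: measurable_mulmx => //; exact: measurable_cstmx.
apply/seteqP; split => w /=; rewrite in_itv/= andbT.
  move=> cA hF; suff : opnorm (A w) <= c by rewrite leNgt cA.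
  apply: opnorm_le_rational => // q.
  by have := hF (pickle q) I; rewrite /F pickleK.
move=> hF; rewrite ltNge; apply/negP => Ac; apply: hF => k _; rewrite /F.
by case: unpickle => [q|//] /=; exact: (proj1 (opnorm_leP _ _ _ c0) Ac).
Qed.

End Measurability.

(** * Gaussian maxima *)

Section Probability.
Context {R : realType} {dT : measure_display} {T : measurableType dT}.
Variable P : probability T R.

(** Real-valued, so that inequalities between probabilities are open to linear arithmetic. *)
Definition pr (A : set T) : R := fine (P A).

Lemma prE A : measurable A -> P A = (pr A)%:E.
Proof. by move=> mA; rewrite fineK// fin_num_measure. Qed.

Lemma pr_ge0 A : 0 <= pr A.
Proof. exact: fine_ge0. Qed.

Lemma pr_le A B : measurable A -> measurable B -> A `<=` B -> pr A <= pr B.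
Proof.
by move=> mA mB AB; rewrite -lee_fin -!prE// le_measure// inE.
Qed.

Lemma pr_le1 A : measurable A -> pr A <= 1.
Proof. by move=> mA; rewrite -lee_fin -prE// probability_le1. Qed.

Lemma prC A : measurable A -> pr (~` A) = 1 - pr A.
Proof.
move=> mA; apply/EFin_inj; rewrite -prE ?probability_setC//; last exact: measurableC.
by rewrite prE.
Qed.

Lemma prU_le A B : measurable A -> measurable B -> pr (A `|` B) <= pr A + pr B.
Proof.
move=> mA mB; rewrite -lee_fin EFinD -!prE//; last exact: measurableU.
exact: measureU2.
Qed.

Lemma pr_bigsetU_le (I : Type) (s : seq I) (F : I -> set T) :
  (forall i, measurable (F i)) ->
  pr (\big[setU/set0]_(i <- s) F i) <= \sum_(i <- s) pr (F i).
Proof.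
move=> mF; elim: s => [|i s IH].
  by rewrite !big_nil /pr measure0.
rewrite !big_cons; apply: le_trans (prU_le _ _ (mF i) _) _.
  exact: bigsetU_measurable.
by rewrite lerD2l.
Qed.

End Probability.

Lemma measurable_set_le_cst (R : realType) dT (T : measurableType dT) (f : T -> R) c :
  measurable_fun [set: T] f -> measurable [set w | f w <= c].
Proof. by move=> mf; apply: measurable_set_ler => //; exact: measurable_cst. Qed.

Lemma measurable_set_between (R : realType) dT (T : measurableType dT) (f : T -> R) a b :
  measurable_fun [set: T] f -> measurable [set w | a <= f w <= b].
Proof.
move=> mf; rewrite (_ : [set w | _] = [set w | a <= f w] `&` [set w | f w <= b]).
  by apply: measurableI; apply: measurable_set_ler => //; exact: measurable_cst.
by apply/seteqP; split => w /=; [move/andP|move=> [-> ->]].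
Qed.

Lemma measurable_set_ltr (R : realType) dT (T : measurableType dT) (f : T -> R) c :
  measurable_fun [set: T] f -> measurable [set w | c < f w].
Proof.
move=> mf; rewrite (_ : [set w | c < f w] = ~` [set w | f w <= c]).
  by apply: measurableC; apply: measurable_set_ler => //; exact: measurable_cst.
by apply/seteqP; split => w /=; rewrite ltNge => /negP.
Qed.

Section GaussianMax.
Context {R : realType} {dT : measure_display} {T : measurableType dT}.
Variables (P : probability T R) (m : nat) (G : T -> 'cV[R]_m) (S : 'M[R]_m).
Hypothesis GS : gaussian_vector P G S.

Let measurable_abs_coord j : measurable_fun [set: T] (fun w => `|G w j 0|).
Proof. by apply: measurableT_comp => //; exact: (proj1 GS). Qed.

Lemma measurable_gaussian_max :
  measurable_fun [set: T] (fun w => maxj (fun j => `|G w j 0|)).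
Proof. exact: measurable_maxj. Qed.

(** In the unit variance case, add the one-sided tails of the combinations along [e_j] and [- e_j].
    Variance 0 occurs when [corrmx] normalizes a nonpositive diagonal entry; then [G_j = 0] almost
    surely. *)
Lemma gaussian_coord_tail j s : 0 <= s -> S j j = 0 \/ S j j = 1 ->
  pr P [set w | s < `|G w j 0|] <= 2 * expR (- s ^+ 2 / 2).
Proof.
move=> s0 [Sj|Sj].
  have := proj2 (proj2 GS (delta_mx j 0)); rewrite quad_delta => /(_ Sj).
  set A := [set w | _] => PA.
  have mA : measurable A.
    rewrite -[X in measurable X]setTI.
    exact: (measurable_gaussian_lin _ _ _ _ GS _ measurableT [set 0] (measurable_set1 _)).
  apply: (@le_trans _ _ (pr P (~` A))).
    apply: pr_le; [exact: measurable_set_ltr|exact: measurableC|].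
    move=> w /= sG; rewrite /A/= trmx_delta -rowE mxE => G0.
    by move: sG; rewrite G0 normr0 ltNge s0.
  by rewrite prC// /pr PA subrr mulr_ge0 ?expR_ge0.
have tail (a : 'cV[R]_m) : (a^T *m S *m a) 0 0 = 1 ->
    pr P [set w | s < (a^T *m G w) 0 0] <= expR (- s ^+ 2 / 2).
  move=> qa; have := proj1 (proj2 GS a); rewrite qa => /(_ ltr01) h.
  have := h _ (measurable_itv `]s, +oo[); rewrite sqrtr1 => hs.
  rewrite -lee_fin -prE; last by apply: measurable_set_ltr; exact: measurable_gaussian_lin GS _.
  rewrite (_ : [set w | _] = [set w | (a^T *m G w) 0 0 \in `]s, +oo[%classic]).
    by rewrite hs normal_prob_tail.
  by apply/seteqP; split => w /=; rewrite inE/= in_itv/= andbT.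
pose e : 'cV[R]_m := delta_mx j 0.
have eG w : (e^T *m G w) 0 0 = G w j 0 by rewrite trmx_delta -rowE mxE.
have NeG w : ((- e)^T *m G w) 0 0 = - G w j 0.
  by rewrite [(- e)^T]linearN mulNmx mxE eG.
have qe : (e^T *m S *m e) 0 0 = 1 by rewrite quad_delta.
have qNe : ((- e)^T *m S *m - e) 0 0 = 1.
  by rewrite mulmxN [(- e)^T]linearN !mulNmx opprK.
have := tail _ qe; have := tail _ qNe.
set B := [set w | _]; set A := [set w | _] => PB PA.
have mA : measurable A by apply: measurable_set_ltr; exact: measurable_gaussian_lin GS _.
have mB : measurable B by apply: measurable_set_ltr; exact: measurable_gaussian_lin GS _.
rewrite mulr_natl mulr2n; apply: le_trans _ (lerD PA PB).
apply: le_trans _ (prU_le _ _ _ mA mB).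
apply: pr_le; [exact: measurable_set_ltr|exact: measurableU|].
move=> w; rewrite /A /B/= NeG eG lter_normr => /orP.
by [].
Qed.

Lemma gaussian_max_tail s : 0 <= s -> (forall j, S j j = 0 \/ S j j = 1) ->
  pr P [set w | s < maxj (fun j => `|G w j 0|)] <= m%:R * (2 * expR (- s ^+ 2 / 2)).
Proof.
move=> s0 S01; pose F j := [set w | s < `|G w j 0|].
have mF j : measurable (F j) by exact: measurable_set_ltr.
apply: (@le_trans _ _ (pr P (\big[setU/set0]_(j < m) F j))).
  apply: pr_le.
  - by apply: measurable_set_ltr; exact: measurable_gaussian_max.
  - exact: bigsetU_measurable.
  - move=> w /= sG; rewrite -bigcup_seq; apply: contrapT => hF.
    move: sG; apply/negP; rewrite -leNgt; apply: maxj_le => // j.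
    rewrite leNgt; apply/negP => sGj; apply: hF; exists j => //=.
    exact: mem_index_enum.
apply: le_trans (pr_bigsetU_le _ _ _ _ mF) _.
rewrite mulr_natl -[X in _ *+ X](card_ord m) -sumr_const.
by apply: ler_sum => j _; exact: gaussian_coord_tail.
Qed.

End GaussianMax.

(** * Comparison of distribution functions *)

Section Comparison.
Context {R : realType} {dT : measure_display} {T : measurableType dT}.
Context {dG : measure_display} {TG : measurableType dG}.
Variables (P : probability T R) (Q : probability TG R).
Variables (Tst Sst : T -> R) (M : TG -> R) (E : set T).
Hypotheses (mT : measurable_fun [set: T] Tst) (mS : measurable_fun [set: T] Sst).
Hypotheses (mM : measurable_fun [set: TG] M) (mE : measurable E).
Hypothesis (M0 : forall w, 0 <= M w).
Variables (s delta tau d phi : R).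
Hypotheses (delta0 : 0 < delta).
Hypothesis Sclose : forall t, 0 <= t ->
  `|pr P [set w | Sst w <= t] - pr Q [set w | M w <= t]| <= d.
Hypothesis Mconc : forall t e, 0 <= t -> 0 < e ->
  pr Q [set w | t <= M w <= t + e] <= e * phi.
Hypotheses (s0 : 0 <= s) (Mtail : pr Q [set w | s < M w] <= tau).
Hypothesis TSclose : forall w, E w -> Sst w <= s -> `|Tst w - Sst w| <= delta.

(** Off [E] or above [s] nothing is known of [Tst]. This costs the probability of the complement of
    [E] and the tail of [Sst], which is carried over from [M] at price [d]. The second [d] is paid
    at the shifted threshold, and [Mconc] pays for the shift. *)
Lemma cdf_comparison (t : R) : 0 <= t ->
  `|pr P [set w | Tst w <= t] - pr Q [set w | M w <= t]| <=
  2 * d + pr P (~` E) + delta * phi + tau.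
Proof.
move=> t0.
have mle := @measurable_set_le_cst R.
have mitv a b : measurable [set w | a <= M w <= b] by exact: measurable_set_between.
have mtail : measurable [set w | s < Sst w] by exact: measurable_set_ltr.
have mEC : measurable (~` E) by exact: measurableC.
have Stail : pr P [set w | s < Sst w] <= d + tau.
  have -> : [set w | s < Sst w] = ~` [set w | Sst w <= s].
    by apply/seteqP; split => w /=; rewrite ltNge => /negP.
  have := Sclose _ s0; rewrite ler_norml => /andP[h _].
  have : pr Q [set w | M w <= s] = 1 - pr Q [set w | s < M w].
    rewrite -prC; last exact: measurable_set_ltr.
    congr (pr Q _).
    by apply/seteqP; split => w /=; [rewrite leNgt => /negP|move/negP; rewrite -leNgt].
  by have := Mtail; rewrite prC; [lra|exact: mle].
(* Common to both directions: an inclusion valid only on [E] and [Sst <= s] yields an inequality up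
   to the cost of the exceptional sets. *)
have bad (A B : set T) : measurable A -> measurable B ->
    (forall w, A w -> E w -> Sst w <= s -> B w) ->
    pr P A <= pr P B + pr P (~` E) + (d + tau).
  move=> mA mB AB.
  apply: (@le_trans _ _ (pr P (B `|` ~` E `|` [set w | s < Sst w]))).
    apply: pr_le => //; first by apply: measurableU => //; exact: measurableU.
    move=> w Aw; have [Ew|nE] := pselect (E w); last by left; right.
    have [Ss|] := leP (Sst w) s; last by right.
    by left; left; exact: AB.
  apply: le_trans (prU_le _ _ _ _ mtail) _; first exact: measurableU.
  by apply: lerD => //; exact: prU_le.
have splitQ (a b : R) : pr Q [set w | M w <= b] <=
    pr Q [set w | M w <= a] + pr Q [set w | a <= M w <= b].
  apply: le_trans _ (prU_le Q _ _ (mle _ _ M a mM) (mitv a b)).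
  apply: pr_le; [exact: mle|by apply: measurableU => //; exact: mle|].
  move=> w /= Mb; have [Ma|Ma] := leP (M w) a; first by left.
  by right; rewrite /= Mb andbT ltW.
have := pr_ge0 P (~` E) => PE0.
have upper : pr P [set w | Tst w <= t] <=
    pr Q [set w | M w <= t] + (2 * d + pr P (~` E) + delta * phi + tau).
  have hb : pr P [set w | Tst w <= t] <=
      pr P [set w | Sst w <= t + delta] + pr P (~` E) + (d + tau).
    apply: bad => //; [exact: mle|exact: mle|].
    move=> w /= Tt Ew Ss; have := TSclose _ Ew Ss.
    by rewrite ler_norml => /andP[? _]; lra.
  have := Sclose (t + delta) (addr_ge0 t0 (ltW delta0)).
  rewrite ler_norml => /andP[_ ?].
  have := splitQ t (t + delta); have := Mconc t delta t0 delta0; lra.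
have lower : pr Q [set w | M w <= t] <=
    pr P [set w | Tst w <= t] + (2 * d + pr P (~` E) + delta * phi + tau).
  have [dt|td] := leP delta t.
    have td0 : 0 <= t - delta by rewrite subr_ge0.
    have hb : pr P [set w | Sst w <= t - delta] <=
        pr P [set w | Tst w <= t] + pr P (~` E) + (d + tau).
      apply: bad => //; [exact: mle|exact: mle|].
      move=> w /= Tt Ew Ss; have := TSclose _ Ew Ss.
      by rewrite ler_norml => /andP[_ ?]; lra.
    have := Sclose (t - delta) td0.
    rewrite ler_norml => /andP[? _].
    have := splitQ (t - delta) t; have := Mconc (t - delta) delta td0 delta0.
    by rewrite subrK; lra.
  (* For [t < delta] the threshold [t - delta] is negative, outside the range of [Sclose]; instead
     [M <= t] lies within [0 <= M <= delta]. *)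
  have : pr Q [set w | M w <= t] <= delta * phi.
    apply: le_trans _ (Mconc 0 delta (lexx 0) delta0).
    apply: pr_le => // [|w /= Mt]; first exact: mle.
    by rewrite M0/= add0r (le_trans Mt) ?ltW.
  have := pr_ge0 P [set w | Tst w <= t].
  have d0 : 0 <= d := le_trans (normr_ge0 _) (Sclose 0 (lexx 0)).
  have : 0 <= tau := le_trans (pr_ge0 _ _) Mtail.
  lra.
by rewrite ler_norml; apply/andP; split; lra.
Qed.

End Comparison.

(** * Correlation matrices *)

Section Correlation.
Context {R : realType}.

(** For a nonpositive entry [Num.sqrt] is 0, and division by 0 gives 0. *)
Lemma corrmx_diag m (A : 'M[R]_m) j : corrmx A j j = 0 \/ corrmx A j j = 1.
Proof.
rewrite mxE; have [A0|A0] := leP (A j j) 0.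
  by left; rewrite ler0_sqrtr// mul0r invr0 mulr0.
right; rewrite -expr2 sqr_sqrtr ?divff ?gt_eqF//; exact: ltW.
Qed.

Lemma corrmx_diag_gt0 m (A : 'M[R]_m) j : 0 < A j j -> 0 < corrmx A j j.
Proof.
move=> A0; rewrite mxE -expr2 sqr_sqrtr ?divff ?gt_eqF//; exact: ltW.
Qed.

Lemma corrmx_sym m (A : 'M[R]_m) : A^T = A -> (corrmx A)^T = corrmx A.
Proof.
by move=> AT; apply/matrixP => a b; rewrite !mxE -{1}AT mxE (mulrC (Num.sqrt _)).
Qed.

(** Test the correlation form at [diag(A)^{1/2} x]. *)
Lemma psd_of_corrmx m (A : 'M[R]_m) : A^T = A -> (forall j, 0 < A j j) ->
  psd (corrmx A) -> psd A.
Proof.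
move=> AT A0 [_ cpos]; split=> // x.
have := cpos (\col_a (Num.sqrt (A a a) * x a 0)).
congr (_ <= _); rewrite !quadE; apply: eq_bigr => a _; apply: eq_bigr => b _.
rewrite !mxE; field.
by rewrite !gt_eqF ?sqrtr_gt0.
Qed.

Lemma psd_of_sandwich m (S V : 'M[R]_m) : S^T = S -> S \in unitmx -> V^T = V ->
  psd (invmx S *m V *m invmx S) -> psd V.
Proof.
move=> ST Su VT [_ pos]; split=> // x; have := pos (S *m x).
by rewrite trmx_mul ST !mulmxA mulmxK// mulmxKV.
Qed.

End Correlation.

(** * Measurability of the statistics, and positivity of [V_n] *)

Section Statistics.
Context {R : realType} {dT : measure_display} {T : measurableType dT}.
Variables (P : probability T R) (n m : nat).
Variables (X : 'I_n -> T -> 'cV[R]_m) (Y : 'I_n -> T -> R).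
Hypothesis mX : forall i a, measurable_fun [set: T] (fun w => X i w a 0).
Hypothesis mY : forall i, measurable_fun [set: T] (Y i).

Let mXmx i : measurable_mx _ _ (X i).
Proof. by move=> a b; rewrite ord1; exact: mX. Qed.

Lemma measurable_Sigma_hat : measurable_mx _ _ (Sigma_hat X).
Proof.
apply: measurable_scalemx; first exact: measurable_cst.
apply: measurable_summx => i.
by apply: measurable_mulmx; last apply: measurable_trmx; exact: mXmx.
Qed.

Lemma measurable_beta_hat : measurable_mx _ _ (beta_hat X Y).
Proof.
apply: measurable_mulmx; first exact/measurable_invmx/measurable_Sigma_hat.
apply: measurable_scalemx; first exact: measurable_cst.
by apply: measurable_summx => i; exact: measurable_scalemx.
Qed.

Lemma measurable_psi_bar : measurable_mx _ _ (psi_bar P X Y).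
Proof.
apply: measurable_scalemx; first exact: measurable_cst.
apply: measurable_summx => i; apply: measurable_scalemx.
  apply: measurable_funB; first exact: mY.
  apply: measurable_mulmx; last exact: measurable_cstmx.
  exact: measurable_trmx.
by apply: measurable_mulmx => //; exact: measurable_cstmx.
Qed.

Lemma measurable_event_E (Omega_hat : T -> 'M[R]_m) eta :
  measurable_mx _ _ Omega_hat -> measurable (event_E P X Y Omega_hat eta).
Proof.
move=> mO.
have mD : measurable_fun [set: T] (D_Sigma P X).
  apply: measurable_opnorm; apply: measurable_addmx; last exact: measurable_cstmx.
  apply: measurable_mulmx; last exact: measurable_cstmx.
  by apply: measurable_mulmx; [exact: measurable_cstmx|exact: measurable_Sigma_hat].
apply: measurableI; first apply: measurableI.
- by apply: measurable_set_ler => //; exact: measurable_cst.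
- apply: measurable_set_ler; last exact: measurable_cst.
  apply: measurable_funM => //; apply: measurable_sqrtr.
  apply: measurable_mulmx; last exact: measurable_psi_bar.
  apply: measurable_mulmx; last exact: measurable_cstmx.
  exact/measurable_trmx/measurable_psi_bar.
- apply: measurable_set_ler; last exact: measurable_cst.
  apply: measurable_maxj => j; apply: measurableT_comp => //.
  apply: measurable_funB; last exact: measurable_cst.
  apply: measurable_sqrtr; apply: measurable_funM; first exact: measurable_cst.
  exact/measurable_invr/mO.
Qed.

(** With [Omega_jj <= 0] the square root of the ratio is 0, so its distance to 1 is 1, which exceeds
    [eta]. *)
Lemma event_E_empty (Omega_hat : T -> 'M[R]_m) eta j : eta < 1 ->
  (forall w j, 0 < Omega_hat w j j) -> Omega_n P X Y j j <= 0 ->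
  event_E P X Y Omega_hat eta = set0.
Proof.
move=> eta1 Oh0 O0; apply/seteqP; split => // w [_ /=].
rewrite leNgt => /negP; apply; apply: lt_le_trans eta1 _.
apply: le_trans _ (ler_maxj _ _ j).
rewrite ler0_sqrtr ?sub0r ?normrN1// mulr_le0_ge0// invr_ge0 ltW//; exact: Oh0.
Qed.

Lemma V_n_psd : Sigma_n P X \in unitmx -> psd (Sigma_n P X) ->
  (forall j, 0 < Omega_n P X Y j j) -> psd (corrmx (Omega_n P X Y)) ->
  psd (V_n P X Y).
Proof.
move=> Su Spsd O0 cpsd; have VT : (V_n P X Y)^T = V_n P X Y by exact: varmx_sym.
apply: (psd_of_sandwich _ (Sigma_n P X)) => //; first exact: (proj1 Spsd).
apply: psd_of_corrmx => //.
by rewrite !trmx_mul trmx_inv (proj1 Spsd) VT mulmxA.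
Qed.

End Statistics.

(** The suprema [Delta_n] and [Phi_AC] are extended reals. Their coefficients are positive, so an
    infinite one makes the right-hand side infinite, and real values remain. *)
Lemma lee_of_finite (R : realType) (D F : \bar R) (x p c tau : R) :
  (0 <= D)%E -> (0 <= F)%E -> 0 < c -> 0 <= p -> 0 <= tau ->
  (forall d f, D = d%:E -> F = f%:E -> x <= 2 * d + p + c * f + tau) ->
  (x%:E <= 2%:E * D + p%:E + c%:E * F + tau%:E)%E.
Proof.
move=> D0 F0 c0 p0 tau0 h.
have cF0 : (0 <= c%:E * F)%E by rewrite mule_ge0// lee_fin ltW.
case: D D0 h => [d| |//] D0 h.
- case: F F0 cF0 h => [f| |//] F0 cF0 h.
  + by rewrite -!EFinM -!EFinD lee_fin h.
  + by rewrite gt0_muley ?lte_fin// addey// addye// leey.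
- rewrite gt0_muley ?lte_fin ?ltr0n// addye//; first by rewrite addye// leey.
  by rewrite gt_eqF// (lt_le_trans _ cF0)// ltNyr.
Qed.

Theorem mainTheorem3 (R : realType) (dT : measure_display) (T : measurableType dT)
  (P : probability T R) (n dim : nat)
  (X : 'I_n -> T -> 'cV[R]_dim) (Y : 'I_n -> T -> R)
  (Omega_hat : T -> 'M[R]_dim)
  (dG : measure_display) (TG : measurableType dG) (PG : probability TG R)
  (G : TG -> 'cV[R]_dim) (eta : R) :
  (0 < n)%N ->
  (forall i a, measurable_fun setT (fun w => X i w a 0)) ->
  (forall i, measurable_fun setT (Y i)) ->
  (forall i a, P.-integrable setT (fun w => ((X i w a 0) ^+ 2)%:E)) ->
  (forall i, P.-integrable setT (fun w => ((Y i w) ^+ 2)%:E)) ->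
  Sigma_n P X \in unitmx ->
  V_n P X Y \in unitmx ->
  (forall j k, measurable_fun setT (fun w => Omega_hat w j k)) ->
  (forall w, (Omega_hat w)^T = Omega_hat w) ->
  (forall w j, 0 < Omega_hat w j j) ->
  gaussian_vector PG G (corrmx (Omega_n P X Y)) ->
  0 < eta ->
  let maxG (w : TG) : R := maxj (fun j => `|G w j 0|) in
  let Tstat (w : T) : R := maxj (fun j =>
        `|(beta_hat X Y w j 0 - beta_n P X Y j 0) / Num.sqrt (Omega_hat w j j)|) in
  let Sstat (w : T) : R := maxj (fun j =>
        `|psi_bar P X Y w j 0 / Num.sqrt (Omega_n P X Y j j)|) in
  let Delta_n : \bar R := ereal_sup [set `| P [set w | (Sstat w <= t)%R]
                   - PG [set w | (maxG w <= t)%R] |%E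
                   | t in [set t : R | (0 <= t)%R]] in
  let Phi_AC : \bar R := ereal_sup [set ((te.2^-1)%:E *
                   PG [set w | (te.1 <= maxG w <= te.1 + te.2)%R])%E
                   | te in [set te : R * R | (0 <= te.1)%R /\ (0 < te.2)%R]] in
  (ereal_sup [set `| P [set w | (Tstat w <= t)%R] - PG [set w | (maxG w <= t)%R] |%E
        | t in [set t : R | (0 <= t)%R]]
   <= 2%:E * Delta_n + P (~` event_E P X Y Omega_hat eta)
      + (C_n P X Y eta * eta)%:E * Phi_AC + (dim%:R / n%:R)%:E)%E.
Proof.
move=> n0 mX mY X2 Y2 Su Vu mO _ Oh0 GS eta0.
pose maxG (w : TG) : R := maxj (fun j => `|G w j 0|).
pose Tstat (w : T) : R := maxj (fun j =>
        `|(beta_hat X Y w j 0 - beta_n P X Y j 0) / Num.sqrt (Omega_hat w j j)|).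
pose Sstat (w : T) : R := maxj (fun j =>
        `|psi_bar P X Y w j 0 / Num.sqrt (Omega_n P X Y j j)|).
pose Delta_n : \bar R := ereal_sup [set `| P [set w | (Sstat w <= t)%R]
                   - PG [set w | (maxG w <= t)%R] |%E
                   | t in [set t : R | (0 <= t)%R]].
pose Phi_AC : \bar R := ereal_sup [set ((te.2^-1)%:E *
                   PG [set w | (te.1 <= maxG w <= te.1 + te.2)%R])%E
                   | te in [set te : R * R | (0 <= te.1)%R /\ (0 < te.2)%R]].
change ((ereal_sup [set `| P [set w | (Tstat w <= t)%R] - PG [set w | (maxG w <= t)%R] |%E
        | t in [set t : R | (0 <= t)%R]]
   <= 2%:E * Delta_n + P (~` event_E P X Y Omega_hat eta)
      + (C_n P X Y eta * eta)%:E * Phi_AC + (dim%:R / n%:R)%:E)%E).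
have mmaxG : measurable_fun [set: TG] maxG by exact: measurable_gaussian_max GS.
have mT : measurable_fun [set: T] Tstat.
  apply: measurable_maxj => j; apply: measurableT_comp => //.
  apply: measurable_funM.
    apply: measurable_funB; last exact: measurable_cst.
    exact: measurable_beta_hat.
  exact/measurable_invr/measurable_sqrtr/mO.
have mS : measurable_fun [set: T] Sstat.
  apply: measurable_maxj => j; apply: measurableT_comp => //.
  apply: measurable_funM; last exact: measurable_cst.
  exact: measurable_psi_bar.
have mE := measurable_event_E P _ _ X Y mX mY Omega_hat eta mO.
have mle := @measurable_set_le_cst R.
have mitv a b : measurable [set w | a <= maxG w <= b] by exact: measurable_set_between.
have maxG0 w : 0 <= maxG w by exact: maxj_ge0.
pose s : R := Num.sqrt (2 * ln (2 * n%:R)).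
have n1 : 1 <= n%:R :> R by rewrite ler1n.
(* The factor 2 keeps the logarithm positive at [n = 1]; then [s], and with it the shift [C_n eta],
   is positive. *)
have ln0 : 0 < ln (2 * n%:R : R) by rewrite ln_gt0//; lra.
have s0 : 0 < s by rewrite sqrtr_gt0 mulr_gt0.
have k0 : 0 <= kappa_n P X Y := cond_num_ge0 _ _.
have Cs : s <= C_n P X Y eta.
  by rewrite /C_n -/s; have := mulr_ge0 k0 (ltW eta0); lra.
have delta0 : 0 < C_n P X Y eta * eta by rewrite mulr_gt0// (lt_le_trans s0).
(* [s^2 = 2 ln (2n)] turns the union bound [2 dim exp (- s^2 / 2)] into [dim / n]. *)
have Mtail : pr PG [set w | s < maxG w] <= dim%:R / n%:R.
  apply: le_trans (gaussian_max_tail _ _ _ _ GS s (ltW s0) (corrmx_diag _ _)) _.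
  rewrite ler_wpM2l// /s sqr_sqrtr; last by rewrite mulr_ge0// ltW.
  rewrite mulNr mulrAC divff// mul1r expRN lnK; last by rewrite posrE; lra.
  by rewrite invfM mulrA divff// mul1r.
have D0 : (0 <= Delta_n)%E.
  by apply: le_trans (abse_ge0 _) (ereal_sup_ubound _); exists 0 => //=.
have F0 : (0 <= Phi_AC)%E.
  apply: le_trans _ (ereal_sup_ubound _); last by exists (0, 1) => //=; split.
  by rewrite mule_ge0// lee_fin invr_ge0.
apply: ub_ereal_sup => _ [t /= t0 <-].
rewrite (prE P _ (mle _ _ _ t mT)) (prE PG _ (mle _ _ _ t mmaxG)).
rewrite (prE P _ (measurableC mE)).
apply: lee_of_finite => // [|d f Dd Ff]; first exact: pr_ge0.
have f0 : 0 <= f by rewrite -lee_fin -Ff.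
have d0 : 0 <= d by rewrite -lee_fin -Dd.
have dn0 : 0 <= dim%:R / n%:R :> R by rewrite divr_ge0.
have Sclose u : 0 <= u ->
    `|pr P [set w | Sstat w <= u] - pr PG [set w | maxG w <= u]| <= d.
  move=> u0; rewrite -lee_fin -Dd -abse_EFin EFinB.
  rewrite -(prE P _ (mle _ _ _ u mS)) -(prE PG _ (mle _ _ _ u mmaxG)).
  by apply: ereal_sup_ubound; exists u.
have Mconc u e : 0 <= u -> 0 < e -> pr PG [set w | u <= maxG w <= u + e] <= e * f.
  move=> u0 e0; rewrite mulrC -ler_pdivrMr// mulrC -lee_fin -Ff EFinM -prE//.
  by apply: ereal_sup_ubound; exists (u, e).
(* Two probabilities differ by at most 1. *)
have trivial_bound : 1 <= 2 * d + pr P (~` event_E P X Y Omega_hat eta) +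
      C_n P X Y eta * eta * f + dim%:R / n%:R ->
    `|pr P [set w | Tstat w <= t] - pr PG [set w | maxG w <= t]| <=
    2 * d + pr P (~` event_E P X Y Omega_hat eta) +
      C_n P X Y eta * eta * f + dim%:R / n%:R.
  apply: le_trans.
  have := pr_ge0 P [set w | Tstat w <= t].
  have := pr_le1 P _ (mle _ _ _ t mT).
  have := pr_ge0 PG [set w | maxG w <= t].
  have := pr_le1 PG _ (mle _ _ _ t mmaxG).
  by rewrite ler_norml; lra.
have pE0 := pr_ge0 P (~` event_E P X Y Omega_hat eta).
have Cf0 : 0 <= C_n P X Y eta * eta * f by rewrite mulr_ge0// ltW.
have [Opos|Oneg] := pselect (forall j, 0 < Omega_n P X Y j j); last first.
  have /existsNP[j /negP] := Oneg; rewrite -leNgt => Oj; apply: trivial_bound.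
  have [eta1|eta1] := ltP eta 1.
    rewrite (event_E_empty _ _ _ _ _ _ _ _ eta1 Oh0 Oj) setC0.
    have -> : pr P [set: T] = 1 by rewrite /pr probability_setT.
    by lra.
  (* As [maxG] is nonnegative, anti-concentration on [[0, s]] bounds all its mass up to [s];
     [eta >= 1] then gives [s <= C_n eta]. *)
  have Mle : 1 - pr PG [set w | s < maxG w] <= pr PG [set w | 0 <= maxG w <= 0 + s].
    rewrite -prC; last exact: measurable_set_ltr.
    apply: pr_le => //; first by apply: measurableC; exact: measurable_set_ltr.
    by move=> w /= /negP; rewrite -leNgt add0r maxG0.
  have := Mconc 0 s (lexx _) s0.
  have : s * f <= C_n P X Y eta * eta * f.
    by rewrite ler_wpM2r// (le_trans Cs)// ler_peMr// (le_trans (ltW s0) Cs).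
  lra.
have Spsd := Sigma_n_psd P _ _ X mX X2.
have cpsd : psd (corrmx (Omega_n P X Y)).
  apply: (gaussian_psd PG _ G _ GS) => [|j]; last exact: corrmx_diag_gt0.
  apply: corrmx_sym; rewrite /Omega_n !trmx_mul trmx_inv (proj1 Spsd).
  by rewrite varmx_sym mulmxA.
have Vpsd := V_n_psd P _ _ X Y Su Spsd Opos cpsd.
apply: (cdf_comparison P PG Tstat Sstat maxG _ mT mS mmaxG mE maxG0 s) => //.
  exact: ltW.
move=> w Ew Ss; apply: (studentized_max_close _ _ _ _ _ Omega_hat) => //.
Qed.
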